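(* Let $M,U\in\mathbb{R}^{p\times p}$ be symmetric with $M$ positive definite and $U$ positive semidefinite, let $1\le u\le d\le p$, and let $\mathcal{E}=\mathcal{E}_M(U)$ be the $M$-envelope of $\mathrm{span}(U)$, of dimension $u$. Assume that the first $d$ eigenvalues of $M$ are distinct with minimal eigen-gap $\Delta>0$, and that $\mathcal{E}\subseteq\mathrm{span}(v_1,\dots,v_d)$. Let $\Delta_U>0$ be the envelope score gap and $\nu=\|U\|_{op}$. Let $\widehat M,\widehat U\in\mathbb{R}^{p\times p}$ be symmetric positive semidefinite and let $\widehat{\mathcal{E}}$ be the sample NIECE subspace computed from $(\widehat M,\widehat U,d,u)$. Let $\epsilon>0$ satisfy $$\epsilon\le\min\left\{\frac{\Delta}{4},\ \frac{\Delta_U}{2}\left(1+\frac{10\nu}{\Delta}\right)^{-1}\right\}.$$ If $\|\widehat M-M\|_{op}\le\epsilon$ and $\|\widehat U-U\|_{op}\le\epsilon$, then $$\|P_{\widehat{\mathcal{E}}}-P_{\mathcal{E}}\|_F\le\frac{2\sqrt{2u}}{\Delta}\,\epsilon .$$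
   Context: Notation: $\|\cdot\|_{op}$ is the spectral norm, $\|\cdot\|_F$ the Frobenius norm, and $P_{\mathcal{S}}$ the orthogonal projection onto a subspace $\mathcal{S}$. A reducing subspace of a symmetric matrix $M$ is a subspace $\mathcal{R}\subseteq\mathbb{R}^p$ with $M=P_{\mathcal{R}}MP_{\mathcal{R}}+(I-P_{\mathcal{R}})M(I-P_{\mathcal{R}})$. The $M$-envelope $\mathcal{E}_M(U)$ is the intersection of all reducing subspaces of $M$ that contain $\mathrm{span}(U)$ (the column space of $U$). $\lambda_1(M)\ge\dots\ge\lambda_p(M)$ are the ordered eigenvalues of $M$, and $v_1,\dots,v_p$ corresponding orthonormal eigenvectors. The minimal eigen-gap is $\Delta=\min_{1\le j\le d}\{\lambda_j(M)-\lambda_{j+1}(M)\}$, with the convention $\lambda_{p+1}(M)=-\infty$. Envelope scores: $\phi_j=v_j^{T}Uv_j$, $j=1,\dots,d$, sorted as $\phi_{(1)}\ge\dots\ge\phi_{(d)}$, with $v_{(j)}$ the eigenvector attaining $\phi_{(j)}$. Under the assumptions, $\mathcal{E}_M(U)=\mathrm{span}(v_{(1)},\dots,v_{(u)})$ and $\phi_{(1)}\ge\dots\ge\phi_{(u)}>\phi_{(u+1)}=\dots=\phi_{(d)}=0$; the envelope score gap is $\Delta_U=\phi_{(u)}=v_{(u)}^{T}Uv_{(u)}>0$. Sample NIECE subspace: let $\widehat v_1,\dots,\widehat v_d$ be orthonormal eigenvectors of $\widehat M$ for its $d$ largest eigenvalues in decreasing order; compute $\widehat\phi_j=\widehat v_j^{T}\widehat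 U\widehat v_j$; let $\widehat v_{(1)},\dots,\widehat v_{(u)}$ be the $\widehat v_j$ with the $u$ largest values of $\widehat\phi_j$; and set $\widehat{\mathcal{E}}=\mathrm{span}(\widehat v_{(1)},\dots,\widehat v_{(u)})$. *)

(* Defs.v *)
(* Following mxalgebra, a subspace of R^p is the row space of a p x p matrix
   (taken in scope %MS) and vectors of R^p are row vectors, so that a matrix
   acts on the right; every matrix acting below is symmetric. *)
From HB Require Import structures.
From mathcomp Require Import all_boot all_order all_algebra.
From mathcomp Require Import all_classical all_reals.

Set Implicit Arguments.
Unset Strict Implicit.
Unset Printing Implicit Defensive.

Import Order.TTheory GRing.Theory Num.Theory.
Local Open Scope ring_scope.

Section Niece.
Variable R : realType.

Definition quadform p (A : 'M[R]_p) (x : 'rV[R]_p) : R := (x *m A *m x^T) 0 0.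

Definition posdef p (A : 'M[R]_p) : Prop :=
  forall x : 'rV[R]_p, x != 0 -> 0 < quadform A x.

Definition possemidef p (A : 'M[R]_p) : Prop :=
  forall x : 'rV[R]_p, 0 <= quadform A x.

Definition frobnorm m n (A : 'M[R]_(m, n)) : R :=
  Num.sqrt (\sum_(i < m) \sum_(j < n) A i j ^+ 2).

(* On a column vector frobnorm is the Euclidean norm. *)
Definition opnorm m n (A : 'M[R]_(m, n)) : R :=
  sup [set frobnorm (A *m x) | x in [set x : 'cV[R]_n | frobnorm x <= 1]]%classic.

(* The projection onto S along its orthogonal complement: the rows x with
   x *m S^T = 0 are the vectors orthogonal to the row space of S. This is the
   real counterpart of spectral.proj_ortho. *)
Definition orthproj p (S : 'M[R]_p) : 'M[R]_p := proj_mx <<S>>%MS (kermx S^T).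

Definition reducing p (M S : 'M[R]_p) : Prop :=
  let P := orthproj S in
  M = P *m M *m P + (1%:M - P) *m M *m (1%:M - P).

(* E is the intersection of all the reducing subspaces of M that contain the
   column space of U. *)
Definition is_envelope p (M U E : 'M[R]_p) : Prop :=
  forall x : 'rV[R]_p,
    (x <= E)%MS <->
    (forall S : 'M[R]_p, reducing M S -> (U^T <= S)%MS -> (x <= S)%MS).

(* lam lists the p eigenvalues of A, with multiplicity, in decreasing order;
   lam`_j is the (j+1)-st one. *)
Definition is_spectrum p (A : 'M[R]_p) (lam : seq R) : Prop :=
  sorted >=%R lam /\ char_poly A = \prod_(a <- lam) ('X - a%:P).

(* The rows of V are orthonormal eigenvectors of A for its d largest
   eigenvalues, in decreasing order. *)
Definition leading_eigenvectors p d (A : 'M[R]_p) (lam : seq R)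
    (V : 'M[R]_(d, p)) : Prop :=
  V *m V^T = 1%:M /\
  forall j : 'I_d, row j V *m A = lam`_j *: row j V.

(* The default value of nth implements the convention that the eigenvalue
   following the last one is -oo; the gap is +oo exactly when d = p = 1
   (for 0 < d <= p). *)
Definition eigengap (d : nat) (lam : seq R) : \bar R :=
  let ev := nth -oo%E [seq a%:E | a <- lam] in
  (\big[mine/+oo]_(j < d) (ev j - ev j.+1))%E.

Definition score p d (U : 'M[R]_p) (V : 'M[R]_(d, p)) (j : 'I_d) : R :=
  quadform U (row j V).

(* The u-th largest score, counted from 1. *)
Definition score_gap p d (U : 'M[R]_p) (V : 'M[R]_(d, p)) (u : nat) : R :=
  nth 0 (sort >=%R [seq score U V j | j : 'I_d]) u.-1.

(* A predicate rather than a function: the eigenvectors, and the selection J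
   when scores are tied, are arbitrary among the admissible ones. *)
Definition is_niece p (d u : nat) (M U E : 'M[R]_p) : Prop :=
  exists (lam : seq R) (V : 'M[R]_(d, p)) (J : {set 'I_d}),
    [/\ is_spectrum M lam,
        leading_eigenvectors M lam V,
        #|J| = u,
        (forall i j : 'I_d, i \in J -> j \notin J -> score U V j <= score U V i)
      & (E :=: \sum_(j in J) <<row j V>>)%MS].

End Niece.

(* Main.v *)
(* Write v_j, vh_j for the leading eigenvectors of M and Mh. By Weyl's
   inequality the j-th eigenvalue mu of Mh is within eps of that of M, so the
   residual mu vh_j - vh_j M = vh_j (Mh - M), of norm at most eps, forces
   1 - <v_j, vh_j>^2 <= (4 eps / (3 Delta))^2. This moves each score by at most
   eps + (8/3) nu eps / Delta. A reducing subspace containing span(U) contains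
   or is orthogonal to v_j, whose eigenvalue is simple, so exactly u scores of M
   are positive, and their eigenvectors span E; the bound on eps keeps the
   sample scores of these u indices above the others, so both subspaces use the
   same index set J. Finally, the squared distance of the projections is at most
   2 sum_(j in J) (1 - <v_j, vh_j>^2). *)
Require Import Defs.
From HB Require Import structures.
From mathcomp Require Import all_boot all_order all_algebra.
From mathcomp Require Import all_classical all_reals.
From mathcomp Require Import ring lra.

Set Implicit Arguments.
Unset Strict Implicit.
Unset Printing Implicit Defensive.

Import Order.TTheory GRing.Theory Num.Theory.
Local Open Scope ring_scope.

(** * Inner product, Frobenius norm and operator norm *)

Section Norms.
Variable R : realType.

Definition dotv p (x y : 'rV[R]_p) : R := (x *m y^T) 0 0.

Lemma dotvE p (x y : 'rV[R]_p) : dotv x y = \sum_k x 0 k * y 0 k.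
Proof. by rewrite /dotv mxE; apply: eq_bigr => k _; rewrite mxE. Qed.

Lemma dotvC p (x y : 'rV[R]_p) : dotv x y = dotv y x.
Proof. by rewrite !dotvE; apply: eq_bigr => k _; rewrite mulrC. Qed.

Lemma dotvDl p (x y z : 'rV[R]_p) : dotv (x + y) z = dotv x z + dotv y z.
Proof. by rewrite /dotv mulmxDl mxE. Qed.

Lemma dotvNl p (x y : 'rV[R]_p) : dotv (- x) y = - dotv x y.
Proof. by rewrite /dotv mulNmx mxE. Qed.

Lemma dotvZl p a (x y : 'rV[R]_p) : dotv (a *: x) y = a * dotv x y.
Proof. by rewrite /dotv -scalemxAl mxE. Qed.

Lemma dotvBl p (x y z : 'rV[R]_p) : dotv (x - y) z = dotv x z - dotv y z.
Proof. by rewrite dotvDl dotvNl. Qed.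

Lemma dotvDr p (x y z : 'rV[R]_p) : dotv x (y + z) = dotv x y + dotv x z.
Proof. by rewrite !(dotvC x) dotvDl. Qed.

Lemma dotvBr p (x y z : 'rV[R]_p) : dotv x (y - z) = dotv x y - dotv x z.
Proof. by rewrite !(dotvC x) dotvBl. Qed.

Lemma dotvZr p a (x y : 'rV[R]_p) : dotv x (a *: y) = a * dotv x y.
Proof. by rewrite !(dotvC x) dotvZl. Qed.

Lemma dotv_mulmx p q (x : 'rV[R]_p) (A : 'M[R]_(p, q)) (y : 'rV[R]_q) :
  dotv (x *m A) y = dotv x (y *m A^T).
Proof. by rewrite /dotv trmx_mul trmxK mulmxA. Qed.

Lemma dotv_row m n p (A : 'M[R]_(m, p)) (B : 'M[R]_(n, p)) i j :
  dotv (row i A) (row j B) = (A *m B^T) i j.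
Proof.
by rewrite dotvE mxE; apply: eq_bigr => k _; rewrite !mxE.
Qed.

Lemma dotv_rowr n p (x : 'rV[R]_p) (A : 'M[R]_(n, p)) k :
  dotv x (row k A) = (x *m A^T) 0 k.
Proof. by rewrite -dotv_row; congr dotv; apply/rowP => i; rewrite mxE. Qed.

Lemma sqr_frobnorm m n (A : 'M[R]_(m, n)) :
  frobnorm A ^+ 2 = \sum_(i < m) \sum_(j < n) A i j ^+ 2.
Proof.
by rewrite sqr_sqrtr//; apply: sumr_ge0 => i _; apply: sumr_ge0 => j _; exact: sqr_ge0.
Qed.

Lemma frobnorm_ge0 m n (A : 'M[R]_(m, n)) : 0 <= frobnorm A.
Proof. exact: sqrtr_ge0. Qed.

Lemma sqr_frobnorm_tr m n (A : 'M[R]_(m, n)) :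
  frobnorm A ^+ 2 = \tr (A *m A^T).
Proof.
rewrite sqr_frobnorm; apply: eq_bigr => i _; rewrite mxE.
by apply: eq_bigr => j _; rewrite mxE expr2.
Qed.

Lemma frobnorm_tr m n (A : 'M[R]_(m, n)) : frobnorm A^T = frobnorm A.
Proof.
rewrite /frobnorm exchange_big; congr Num.sqrt.
by apply: eq_bigr => i _; apply: eq_bigr => j _; rewrite mxE.
Qed.

Lemma sqr_frobnorm_row p (x : 'rV[R]_p) : frobnorm x ^+ 2 = dotv x x.
Proof. by rewrite sqr_frobnorm_tr /mxtrace big_ord1. Qed.

Lemma frobnorm0_eq0 m n (A : 'M[R]_(m, n)) : frobnorm A = 0 -> A = 0.
Proof.
move=> A0; apply/matrixP => i j; rewrite mxE; apply/eqP; rewrite -sqrf_eq0.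
have sum_ge0 (k : 'I_m) : 0 <= \sum_(l < n) A k l ^+ 2.
  by apply: sumr_ge0 => l _; exact: sqr_ge0.
have /eqP := sqr_frobnorm A; rewrite A0 expr0n eq_sym psumr_eq0//.
move=> /allP/(_ i (mem_index_enum _)) /=.
rewrite psumr_eq0; last by move=> l _; exact: sqr_ge0.
by move=> /allP/(_ j (mem_index_enum _)).
Qed.

Lemma dotvv_ge0 p (x : 'rV[R]_p) : 0 <= dotv x x.
Proof. by rewrite -sqr_frobnorm_row sqr_ge0. Qed.

Lemma dotvv_eq0 p (x : 'rV[R]_p) : (dotv x x == 0) = (x == 0).
Proof.
apply/eqP/eqP => [|->]; last by rewrite /dotv mul0mx mxE.
rewrite -sqr_frobnorm_row => /eqP; rewrite sqrf_eq0 => /eqP.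
exact: frobnorm0_eq0.
Qed.

Lemma dotvv_gt0 p (x : 'rV[R]_p) : (0 < dotv x x) = (x != 0).
Proof. by rewrite lt_def dotvv_eq0 dotvv_ge0 andbT. Qed.

(** The squared norm of [dotv y y *: x - dotv x y *: y] is [dotv y y] times the difference of the
    two sides. *)
Lemma cauchy_schwarz p (x y : 'rV[R]_p) :
  dotv x y ^+ 2 <= dotv x x * dotv y y.
Proof.
have [->|y0] := eqVneq y 0.
  by rewrite /dotv trmx0 !mulmx0 !mxE expr0n mulr0.
have yy : 0 < dotv y y by rewrite dotvv_gt0.
have := dotvv_ge0 (dotv y y *: x - dotv x y *: y).
rewrite dotvBl !dotvBr !dotvZl !dotvZr (dotvC y x) => h.
have {}h : 0 <= dotv y y * (dotv x x * dotv y y - dotv x y ^+ 2).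
  by move: h; congr (0 <= _); ring.
by rewrite -subr_ge0; move: h; rewrite pmulr_rge0.
Qed.

Lemma normr_dotv_le p (x y : 'rV[R]_p) :
  `|dotv x y| <= frobnorm x * frobnorm y.
Proof.
rewrite -ler_sqr ?nnegrE ?mulr_ge0 ?frobnorm_ge0//.
by rewrite real_normK ?num_real// exprMn !sqr_frobnorm_row cauchy_schwarz.
Qed.

Lemma frobnorm_mulmx_le m n (A : 'M[R]_(m, n)) (x : 'cV[R]_n) :
  frobnorm (A *m x) <= frobnorm A * frobnorm x.
Proof.
rewrite -ler_sqr ?nnegrE ?mulr_ge0 ?frobnorm_ge0//.
rewrite exprMn (sqr_frobnorm A) sqr_frobnorm mulr_suml.
apply: ler_sum => i _; rewrite big_ord1.
have -> : (A *m x) i 0 = dotv (row i A) x^T.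
  by rewrite dotvE mxE; apply: eq_bigr => k _; rewrite !mxE.
apply: le_trans (cauchy_schwarz _ _) _.
rewrite -(sqr_frobnorm_row x^T) frobnorm_tr -sqr_frobnorm_row sqr_frobnorm.
rewrite big_ord1 le_eqVlt; apply/orP; left; apply/eqP; congr (_ * _).
by apply: eq_bigr => k _; rewrite mxE.
Qed.

Lemma frobnormZ m n a (A : 'M[R]_(m, n)) :
  frobnorm (a *: A) = `|a| * frobnorm A.
Proof.
rewrite /frobnorm -[X in X * _]sqrtr_sqr -sqrtrM ?sqr_ge0//; congr Num.sqrt.
rewrite mulr_sumr; apply: eq_bigr => i _; rewrite mulr_sumr.
by apply: eq_bigr => j _; rewrite mxE exprMn.
Qed.

Lemma frobnorm0 m n : frobnorm (0 : 'M[R]_(m, n)) = 0.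
Proof. by rewrite -(scale0r 0) frobnormZ normr0 mul0r. Qed.

(** By Cauchy-Schwarz [frobnorm A] bounds the set defining [opnorm A], so the supremum is a genuine
    one and not a default value. *)
Lemma frobnorm_le_opnorm m n (A : 'M[R]_(m, n)) (x : 'cV[R]_n) :
  frobnorm x <= 1 -> frobnorm (A *m x) <= opnorm A.
Proof.
move=> x1; apply: ub_le_sup; last by exists x.
exists (frobnorm A) => _ [y /= y1 <-].
apply: le_trans (frobnorm_mulmx_le _ _) _.
by rewrite ler_piMr ?frobnorm_ge0.
Qed.

Lemma opnorm_ge0 m n (A : 'M[R]_(m, n)) : 0 <= opnorm A.
Proof.
apply: le_trans (frobnorm_ge0 (A *m 0)) _.
by apply: frobnorm_le_opnorm; rewrite frobnorm0.
Qed.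

Lemma frobnorm_mulmx_opnorm m n (A : 'M[R]_(m, n)) (x : 'cV[R]_n) :
  frobnorm (A *m x) <= opnorm A * frobnorm x.
Proof.
have [x0|x0] := eqVneq (frobnorm x) 0.
  by rewrite x0 (frobnorm0_eq0 x0) mulmx0 frobnorm0 mulr0.
have xgt0 : 0 < frobnorm x by rewrite lt_def x0 frobnorm_ge0.
have /(frobnorm_le_opnorm A) : frobnorm ((frobnorm x)^-1 *: x) <= 1.
  by rewrite frobnormZ ger0_norm ?invr_ge0 ?frobnorm_ge0// mulVf.
rewrite -scalemxAr frobnormZ ger0_norm ?invr_ge0 ?frobnorm_ge0//.
by rewrite mulrC ler_pdivrMr.
Qed.

(** The matrix is moved onto [y]: [y *m A^T] is the transpose of [A *m y^T], so the norm of [A]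
    itself appears and not that of its transpose. *)
Lemma normr_dotv_mulmx_le p q (x : 'rV[R]_p) (A : 'M[R]_(p, q)) (y : 'rV[R]_q) :
  `|dotv (x *m A) y| <= opnorm A * (frobnorm x * frobnorm y).
Proof.
rewrite dotv_mulmx; apply: le_trans (normr_dotv_le _ _) _.
rewrite mulrCA ler_wpM2l ?frobnorm_ge0//.
by rewrite -frobnorm_tr trmx_mul trmxK -(frobnorm_tr y) frobnorm_mulmx_opnorm.
Qed.

Lemma quadformE p (A : 'M[R]_p) (x : 'rV[R]_p) :
  quadform A x = dotv (x *m A) x.
Proof. by []. Qed.

End Norms.

(** * Orthogonal diagonalization of real symmetric matrices *)

Section Spectral.
Variable R : realType.

(* A Householder reflection exchanging the first basis vector and v. *)
Lemma orthogonal_with_first_row p (v : 'rV[R]_p.+1) :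
  dotv v v = 1 -> exists2 H : 'M[R]_p.+1, H *m H^T = 1%:M & row 0 H = v.
Proof.
move=> vv; pose e : 'rV[R]_p.+1 := delta_mx 0 0; pose w := e - v.
have [w0|w0] := eqVneq w 0.
  exists 1%:M; first by rewrite trmx1 mulmx1.
  by rewrite row1; apply/eqP; rewrite -subr_eq0; apply/eqP.
have ww0 : dotv w w != 0 by rewrite dotvv_eq0.
have ee : dotv e e = 1.
  by rewrite /dotv trmx_delta mul_delta_mx mxE.
have wwE : dotv w w = 2 * dotv e w.
  by rewrite /w !dotvBr !dotvBl ee vv (dotvC v e); ring.
pose c := 2 / dotv w w.
exists (1%:M - c *: (w^T *m w)).
  have -> : (1%:M - c *: (w^T *m w))^T = 1%:M - c *: (w^T *m w).
    by rewrite [LHS]raddfB [X in _ - X]linearZ /= trmx1 trmx_mul trmxK.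
  rewrite mulmxBr mulmx1 mulmxBl mul1mx -scalemxAl -scalemxAr scalerA.
  have -> : w^T *m w *m (w^T *m w) = dotv w w *: (w^T *m w).
    rewrite mulmxA -(mulmxA w^T w) [w *m w^T]mx11_scalar -/(dotv w w).
    by rewrite mul_mx_scalar -scalemxAl.
  rewrite scalerA -[in RHS](subr0 1%:M) -addrA; congr (_ + _).
  rewrite -opprD oppr0; apply/eqP; rewrite oppr_eq0 -scalerBl -scalerDl.
  have -> : c + (c - c * c * dotv w w) = 0 by rewrite /c; field.
  by rewrite scale0r.
(* Since [v = e - w], the reflection has to subtract exactly [w] from [e]; this is the identity
   [wwE]. *)
rewrite -[RHS](subKr e) -/w raddfB /= row1; congr (_ - _).
rewrite linearZ /= row_mul -tr_col.
have -> : (col 0 w)^T = (dotv e w)%:M.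
  rewrite [LHS]mx11_scalar; congr (_%:M).
  rewrite dotvE (bigD1 0)//= big1 ?addr0 => [|k k0].
    by rewrite !mxE !eqxx mul1r.
  by rewrite !mxE (negPf k0) andbF mul0r.
rewrite mul_scalar_mx scalerA /c.
suff -> : 2 / dotv w w * dotv e w = 1 by rewrite scale1r.
by rewrite mulrAC -wwE mulfV.
Qed.

Lemma char_poly_conj p (H A : 'M[R]_p) :
  H *m H^T = 1%:M -> char_poly (H *m A *m H^T) = char_poly A.
Proof.
move=> HH; rewrite /char_poly.
have -> : char_poly_mx (H *m A *m H^T) =
    map_mx polyC H *m char_poly_mx A *m map_mx polyC H^T.
  rewrite /char_poly_mx mulmxBr mulmxBl !map_mxM; congr (_ - _).
  by rewrite mul_mx_scalar -scalemxAl -map_mxM HH map_mx1 scalemx1.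
rewrite !det_mulmx mulrAC -det_mulmx -map_mxM HH map_mx1 det1 mul1r//.
Qed.

Lemma char_poly_block_diag m n (A : 'M[R]_m) (B : 'M[R]_n) :
  char_poly (block_mx A 0 0 B) = char_poly A * char_poly B.
Proof.
rewrite /char_poly /char_poly_mx map_block_mx !map_mx0 scalar_mx_block.
by rewrite opp_block_mx add_block_mx !oppr0 !addr0 det_ublock.
Qed.

(** Deflation by induction on [p]: a unit eigenvector for the head of [lam] is completed to an
    orthogonal matrix, and conjugation splits off a block of size 1. The assumed factorization
    supplies every eigenvalue and fixes the order of the rows of [Q]. *)
Lemma symmetric_spectral p (M : 'M[R]_p) (lam : seq R) :
  M^T = M -> char_poly M = \prod_(a <- lam) ('X - a%:P) ->
  exists2 Q : 'M[R]_p, Q *m Q^T = 1%:M &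
    Q *m M = diag_mx (\row_(i < p) lam`_i) *m Q.
Proof.
elim: p M lam => [|p IHp] M lam Msym Mchar.
  by exists 1%:M; [rewrite trmx1 mulmx1 | rewrite flatmx0; apply/matrixP => -[]].
case: lam Mchar => [|a l] Mchar.
  have := size_char_poly M.
  by rewrite Mchar big_nil size_poly1.
have /eigenvalueP[v vM v0] : eigenvalue M a.
  by rewrite eigenvalue_root_char Mchar root_prod_XsubC mem_head.
have [H HH Hv] : exists2 H : 'M[R]_p.+1, H *m H^T = 1%:M &
    row 0 H = (frobnorm v)^-1 *: v.
  apply: orthogonal_with_first_row.
  have fv0 : frobnorm v != 0.
    by apply: contra v0 => /eqP/frobnorm0_eq0->.
  by rewrite dotvZl dotvZr -sqr_frobnorm_row; field.
have HtH : H^T *m H = 1%:M by apply: mulmx1C.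
(* The size [1 + p] gives access to the block operations, and the existential keeps [N] opaque. *)
have [N Ndef] : exists N : 'M[R]_(1 + p), N = H *m M *m H^T by eexists.
have Nsym : N^T = N by rewrite Ndef !trmx_mul trmxK Msym mulmxA.
(* The first row of [H] is an eigenvector of [M], so the first row of [N] is a multiple of the first
   basis vector; symmetry then clears the first column. *)
have N0 : row 0 N = a *: row 0 1%:M.
  by rewrite -HH Ndef !row_mul Hv -scalemxAl vM -!scalemxAl !scalerA mulrC.
have Nul : ulsubmx N = a%:M.
  rewrite [LHS]mx11_scalar; congr (_%:M).
  have := congr1 (fun B : 'rV__ => B 0 0) N0; rewrite !mxE eqxx mulr1 => <-.
  by congr (N _ _); apply: val_inj.
have Nur : ursubmx N = 0.
  apply/matrixP => i j; rewrite ord1 !mxE.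
  have := congr1 (fun B : 'rV__ => B 0 (rshift 1 j)) N0; rewrite !mxE /= mulr0 => <-.
  by congr (N _ _); apply: val_inj.
have Ndl : dlsubmx N = 0.
  by rewrite -Nsym -trmx_ursub Nur trmx0.
have NE : N = block_mx a%:M 0 0 (drsubmx N).
  by rewrite -[LHS]submxK Nul Nur Ndl.
have [||Q' QQ' Q'N] := IHp (drsubmx N) l.
- by rewrite trmx_drsub Nsym.
(* Cancelling the factor ['X - a%:P] in two expressions of [char_poly N] leaves the characteristic
   polynomial of the lower block. *)
- have : char_poly N = \prod_(b <- a :: l) ('X - b%:P).
    by rewrite Ndef char_poly_conj.
  rewrite [in X in X -> _]NE char_poly_block_diag big_cons.
  have -> : char_poly (a%:M : 'M_1) = 'X - a%:P.
    by rewrite /char_poly /char_poly_mx det_mx11 !mxE /= mulr1n.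
  have X0 : 'X - a%:P != 0 by rewrite polyXsubC_eq0.
  exact: (mulfI X0).
pose D : 'M[R]_(1 + p) := block_mx a%:M 0 0 (diag_mx (\row_(i < p) l`_i)).
have DE : diag_mx (\row_(i < p.+1) (a :: l)`_i) = D.
  rewrite /D -diag_const_mx -diag_mx_row; congr diag_mx.
  apply/rowP => i; rewrite mxE.
  case: (@split_ordP 1 p i) => j ->.
    by apply: etrans (esym (row_mxEl _ _ _ _)); rewrite mxE ord1.
  by apply: etrans (esym (row_mxEr _ _ _ _)); rewrite mxE.
pose B : 'M[R]_(1 + p) := block_mx 1%:M 0 0 Q'.
have BB : B *m B^T = 1%:M.
  rewrite /B tr_block_mx mulmx_block !trmx0 !mul0mx !mulmx0 trmx1 mulmx1 QQ'.
  by rewrite !addr0 add0r -scalar_mx_block.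
have BN : B *m N = D *m B.
  rewrite NE /B /D !mulmx_block Q'N.
  by rewrite !mul0mx !mulmx0 !addr0 add0r mul1mx mulmx1.
exists (B *m H).
  by rewrite trmx_mul mulmxA -(mulmxA _ H) HH mulmx1 BB.
by rewrite DE mulmxA -BN Ndef -!mulmxA HtH mulmx1.
Qed.

End Spectral.

(** * Orthogonal projections onto row spaces *)

Section OrthogonalProjection.
Variables (R : realType) (p : nat).
Implicit Types S : 'M[R]_p.

(** If [x = y *m S] and [x *m S^T = 0], then [dotv x x = 0], which over the reals forces [x = 0]. *)
Lemma capmx_kermx_tr S : (<<S>> :&: kermx S^T)%MS = 0.
Proof.
apply/eqP/rowV0P => x; rewrite sub_capmx genmxE => /andP[/submxP[y xE]].
move=> /sub_kermxP xS; apply/eqP; rewrite -dotvv_eq0.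
by rewrite /dotv {2}xE trmx_mul mulmxA xS mul0mx mxE.
Qed.

(** The two summands meet trivially and their ranks add up to [p]. *)
Lemma sub_addsmx_kermx_tr m (x : 'M[R]_(m, p)) S :
  (x <= <<S>> + kermx S^T)%MS.
Proof.
apply: submx_full; rewrite -col_leq_rank (mxrank_disjoint_sum (capmx_kermx_tr S)).
by rewrite mxrank_gen mxrank_ker mxrank_tr subnKC ?rank_leq_row.
Qed.

Lemma orthproj_id m (x : 'M[R]_(m, p)) S :
  (x <= S)%MS -> x *m orthproj S = x.
Proof. by move=> xS; rewrite proj_mx_id ?capmx_kermx_tr ?genmxE. Qed.

Lemma orthproj_0 m (x : 'M[R]_(m, p)) S :
  x *m S^T = 0 -> x *m orthproj S = 0.
Proof. by move=> /sub_kermxP xS; rewrite proj_mx_0 ?capmx_kermx_tr. Qed.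

Lemma orthproj_sub m (x : 'M[R]_(m, p)) S : (x *m orthproj S <= S)%MS.
Proof. by have := proj_mx_sub <<S>>%MS (kermx S^T) x; rewrite genmxE. Qed.

Lemma orthproj_compl m (x : 'M[R]_(m, p)) S :
  (x - x *m orthproj S) *m S^T = 0.
Proof. by apply/sub_kermxP/proj_mx_compl_sub/sub_addsmx_kermx_tr. Qed.

Lemma orthproj_idem S : orthproj S *m orthproj S = orthproj S.
Proof. by apply: orthproj_id; rewrite -[X in (X <= _)%MS]mul1mx orthproj_sub. Qed.

Lemma orthproj_full S : \rank S = p -> orthproj S = 1%:M.
Proof.
move=> Sp; rewrite -[LHS]mul1mx orthproj_id// submx_full//.
by rewrite -col_leq_rank Sp.
Qed.

(** The identity splits into [W^T *m W], whose rows lie in [S], and a remainder orthogonal to [S],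
    which the projection kills. *)
Lemma orthproj_orthonormal n (W : 'M[R]_(n, p)) S :
  W *m W^T = 1%:M -> (S :=: W)%MS -> orthproj S = W^T *m W.
Proof.
move=> WW SW; have /submxP[Y SE] : (S <= W)%MS by rewrite SW.
rewrite -[LHS]mul1mx -[X in X *m _](subrK (W^T *m W)) mulmxDl.
rewrite orthproj_0 ?add0r; last first.
  by rewrite SE trmx_mul mulmxBl mul1mx mulmxA -(mulmxA W^T) WW mulmx1 subrr.
by rewrite orthproj_id// SW submxMl.
Qed.

(** Both projections have trace [n], so the squared distance is [2 * n] minus twice the sum of the
    squared entries of [A *m B^T]. Only the diagonal entries are kept. *)
Lemma sqr_frobnorm_proj_sub n (A B : 'M[R]_(n, p)) :
  A *m A^T = 1%:M -> B *m B^T = 1%:M ->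
  frobnorm (A^T *m A - B^T *m B) ^+ 2 <=
  2 * \sum_(i < n) (1 - dotv (row i A) (row i B) ^+ 2).
Proof.
move=> AA BB; rewrite sqr_frobnorm_tr.
rewrite [X in _ *m X]raddfB /= !trmx_mul !trmxK mulmxBl !mulmxBr.
have idem (C : 'M[R]_(n, p)) : C *m C^T = 1%:M ->
    C^T *m C *m (C^T *m C) = C^T *m C.
  by move=> CC; rewrite mulmxA -(mulmxA C^T) CC mulmx1.
rewrite !idem// !raddfB /=.
have tr (C : 'M[R]_(n, p)) : C *m C^T = 1%:M -> \tr (C^T *m C) = n%:R.
  by move=> CC; rewrite mxtrace_mulC CC mxtrace1.
rewrite !tr// [\tr (_ *m (A^T *m A))]mxtrace_mulC.
have -> : \tr (A^T *m A *m (B^T *m B)) = \sum_i \sum_j (A *m B^T) i j ^+ 2.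
  rewrite -sqr_frobnorm sqr_frobnorm_tr trmx_mul trmxK.
  by rewrite -!mulmxA mxtrace_mulC !mulmxA.
rewrite sumrB sumr_const card_ord.
have : \sum_i dotv (row i A) (row i B) ^+ 2 <=
    \sum_i \sum_j (A *m B^T) i j ^+ 2.
  apply: ler_sum => i _; rewrite (bigD1 i)//= dotv_row lerDl.
  by apply: sumr_ge0 => j _; exact: sqr_ge0.
lra.
Qed.

End OrthogonalProjection.

(** * Perturbation of eigenvectors, eigenvalues and scores *)

Section Perturbation.
Variables (R : realType) (p : nat).

Section Eigenbasis.
Variables (M Q : 'M[R]_p) (lam : seq R).
Hypotheses (Msym : M^T = M) (QQ : Q *m Q^T = 1%:M).
Hypothesis QM : Q *m M = diag_mx (\row_(i < p) lam`_i) *m Q.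

Let row_QM k : row k Q *m M = lam`_k *: row k Q.
Proof. by rewrite -row_mul QM mul_diag_mx; apply/rowP => l; rewrite !mxE. Qed.

Lemma dotv_eigenbasis x y :
  dotv x y = \sum_k dotv x (row k Q) * dotv y (row k Q).
Proof.
under eq_bigr do rewrite !dotv_rowr.
by rewrite -dotvE dotv_mulmx trmxK -mulmxA (mulmx1C QQ) mulmx1.
Qed.

Lemma coord_mulmx x k : dotv (x *m M) (row k Q) = lam`_k * dotv x (row k Q).
Proof. by rewrite dotv_mulmx Msym row_QM dotvZr. Qed.

Lemma dotv_mulmx_eigenbasis x :
  dotv (x *m M) x = \sum_(k < p) lam`_k * dotv x (row k Q) ^+ 2.
Proof.
rewrite dotv_eigenbasis; apply: eq_bigr => k _.
by rewrite coord_mulmx expr2 mulrA.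
Qed.

(** Comparing coordinates in the eigenvalue equation kills all but the [j]-th one. Collinearity with
    [row j Q] is expressed through inner products with an arbitrary [y]. *)
Lemma simple_eigenvector (j : 'I_p) x :
  (forall k : 'I_p, k != j -> lam`_k != lam`_j) ->
  x *m M = lam`_j *: x ->
  forall y, dotv x y = dotv x (row j Q) * dotv y (row j Q).
Proof.
move=> simple xM y; rewrite dotv_eigenbasis (bigD1 j)//= big1 ?addr0// => k kj.
have /eqP := coord_mulmx x k; rewrite xM dotvZl eq_sym -subr_eq0 -mulrBl mulf_eq0.
by rewrite subr_eq0 (negPf (simple _ kj)) => /eqP->; rewrite mul0r.
Qed.

(* The residual argument behind the Davis-Kahan theorem: the residual of the
   approximate eigenpair (mu, vh) of M is large away from the j-th axis. *)
Lemma sin_theta_le (Mh : 'M[R]_p) (j : 'I_p) (v vh : 'rV[R]_p) (mu eps delta : R) :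
  Mh^T = Mh -> 0 < delta -> 0 <= eps -> eps <= delta / 4 ->
  (forall k : 'I_p, k != j -> delta <= `|lam`_k - lam`_j|) ->
  dotv v v = 1 -> v *m M = lam`_j *: v ->
  dotv vh vh = 1 -> vh *m Mh = mu *: vh ->
  `|mu - lam`_j| <= eps -> opnorm (Mh - M) <= eps ->
  1 - dotv v vh ^+ 2 <= (4 * eps / (3 * delta)) ^+ 2.
Proof.
move=> Mhsym d0 e0 ed gap vv vM hh hM mule opne.
have simple (k : 'I_p) : k != j -> lam`_k != lam`_j.
  by move=> /gap; apply: contraTneq => ->; rewrite subrr normr0 -ltNge.
have coord_v := simple_eigenvector simple vM.
(* As a unit vector on a simple eigenline, [v] is [row j Q] up to a sign, which the square
   removes. *)
have -> : dotv v vh ^+ 2 = dotv vh (row j Q) ^+ 2.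
  by rewrite coord_v exprMn expr2 -coord_v vv mul1r.
have norm1 (x : 'rV[R]_p) : dotv x x = 1 -> frobnorm x = 1.
  move=> xx; apply/eqP; rewrite -(@eqrXn2 _ 2)// ?frobnorm_ge0//.
  by rewrite sqr_frobnorm_row xx expr1n.
have res_le : dotv (vh *m (Mh - M)) (vh *m (Mh - M)) <= eps ^+ 2.
  rewrite -sqr_frobnorm_row ler_sqr ?nnegrE ?frobnorm_ge0//.
  apply: le_trans opne; rewrite -frobnorm_tr trmx_mul.
  rewrite [X in X *m _]raddfB /= Mhsym Msym.
  apply: le_trans (frobnorm_mulmx_opnorm _ _) _.
  by rewrite frobnorm_tr norm1 ?mulr1.
have res_coord k : dotv (vh *m (Mh - M)) (row k Q) =
    (mu - lam`_k) * dotv vh (row k Q).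
  by rewrite mulmxBr hM dotvBl dotvZl coord_mulmx mulrBl.
have cE : 1 - dotv vh (row j Q) ^+ 2 =
    \sum_(k | k != j) dotv vh (row k Q) ^+ 2.
  rewrite -hh dotv_eigenbasis (bigD1 j)//= -expr2 addrAC subrr add0r.
  by apply: eq_bigr => k _; rewrite expr2.
(* By the triangle inequality [mu] stays at distance at least [delta - eps], hence [3 * delta / 4],
   from every other eigenvalue. The [j]-th coordinate of the residual is dropped. *)
have : (3 * delta / 4) ^+ 2 * (1 - dotv vh (row j Q) ^+ 2) <= eps ^+ 2.
  apply: le_trans res_le; rewrite cE mulr_sumr [leRHS]dotv_eigenbasis.
  rewrite [leRHS](bigD1 j)//=.
  rewrite -[X in X <= _]add0r lerD// -?expr2 ?sqr_ge0//.
  apply: ler_sum => k /gap kj; rewrite res_coord -expr2 [leRHS]exprMn.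
  rewrite ler_wpM2r ?sqr_ge0// -[X in _ <= X]real_normK ?num_real//.
  rewrite ler_sqr ?nnegrE ?normr_ge0//; last by lra.
  have := ler_distD mu (lam`_k) (lam`_j); rewrite (distrC _ mu); lra.
have -> : (4 * eps / (3 * delta)) ^+ 2 = eps ^+ 2 / (3 * delta / 4) ^+ 2.
  by field; rewrite gt_eqF.
rewrite ler_pdivlMr; last by rewrite exprn_gt0//; lra.
by rewrite mulrC.
Qed.

End Eigenbasis.

Lemma sorted_ge_nth (lam : seq R) i j :
  sorted >=%R lam -> (i <= j)%N -> (j < size lam)%N -> lam`_j <= lam`_i.
Proof.
move=> srt ij jn; have := sorted_leq_nth ge_trans lexx 0 srt.
by move=> /(_ i j); apply => //; rewrite inE// (leq_ltn_trans ij).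
Qed.

(** The Courant-Fischer argument with one test vector: counting from 0, [x] lies in the span of rows
    0 to [j] of [Q] and is orthogonal to the rows of [Qh] before [j]. The two quadratic forms at [x]
    then compare the [j]-th eigenvalues. *)
Lemma weyl_le (M Mh : 'M[R]_p) (lam lamh : seq R) eps (j : 'I_p) :
  M^T = M -> Mh^T = Mh -> is_spectrum M lam -> is_spectrum Mh lamh ->
  (forall x, dotv (x *m M) x <= dotv (x *m Mh) x + eps * dotv x x) ->
  lam`_j <= lamh`_j + eps.
Proof.
move=> Msym Mhsym [srt Mchar] [srth Mhchar] MMh.
have size_spectrum (A : 'M[R]_p) s :
    char_poly A = \prod_(a <- s) ('X - a%:P) -> size s = p.
  by move=> As; have := size_char_poly A; rewrite As size_prod_XsubC => -[].
have [Q QQ QM] := symmetric_spectral Msym Mchar.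
have [Qh QQh QMh] := symmetric_spectral Mhsym Mhchar.
(* The p - 1 linear conditions that x has no component on the last p - 1 - j
   rows of Q nor on the first j rows of Qh have a nonzero solution. *)
pose N : 'M[R]_p :=
  \matrix_(k < p) (if (j < k)%N then row k Q
                   else if (k < j)%N then row k Qh else 0).
have rowN k : row k N = if (j < k)%N then row k Q
                        else if (k < j)%N then row k Qh else 0 by rewrite rowK.
(* Row [j] of [N] is zero, so [N^T] is singular; a vector in its kernel is orthogonal to every row
   of [N]. *)
have /det0P[x x0 xN] : \det N^T == 0.
  rewrite det_tr; apply/det0P; exists (delta_mx 0 j).
    apply/negP => /eqP/rowP/(_ j); rewrite !mxE !eqxx => /eqP.
    by rewrite oner_eq0.
  by rewrite -rowE rowN ltnn.
have xNk k : dotv x (row k N) = 0 by rewrite dotv_rowr xN mxE.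
have xx : 0 < dotv x x by rewrite dotvv_gt0.
have lo : lam`_j * dotv x x <= dotv (x *m M) x.
  rewrite (dotv_mulmx_eigenbasis Msym QQ QM) (dotv_eigenbasis QQ) mulr_sumr.
  apply: ler_sum => k _; rewrite -expr2.
  have [jk|kj] := ltnP j k.
    by have := xNk k; rewrite rowN jk => ->; rewrite expr0n !mulr0.
  by rewrite ler_wpM2r ?sqr_ge0// sorted_ge_nth// (size_spectrum _ _ Mchar).
have hi : dotv (x *m Mh) x <= lamh`_j * dotv x x.
  rewrite (dotv_mulmx_eigenbasis Mhsym QQh QMh) (dotv_eigenbasis QQh) mulr_sumr.
  apply: ler_sum => k _; rewrite -expr2.
  have [kj|jk] := ltnP k j.
    have := xNk k; rewrite rowN kj ltnNge ltnW//= => ->.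
    by rewrite expr0n !mulr0.
  by rewrite ler_wpM2r ?sqr_ge0// sorted_ge_nth// (size_spectrum _ _ Mhchar).
rewrite -(ler_pM2r xx) mulrDl.
exact: le_trans lo (le_trans (MMh x) (lerD hi (lexx _))).
Qed.

(** Factoring the change of vector through [vh - v] and [vh + v] makes the bound independent of the
    signs of the eigenvectors, so they need not be aligned. *)
Lemma score_perturbation (U Uh : 'M[R]_p) (v vh : 'rV[R]_p) eps s :
  U^T = U -> dotv v v = 1 -> dotv vh vh = 1 -> 0 <= s ->
  1 - dotv v vh ^+ 2 <= s ^+ 2 -> opnorm (Uh - U) <= eps ->
  `|quadform Uh vh - quadform U v| <= eps + 2 * opnorm U * s.
Proof.
move=> Usym vv hh s0 sin opne; rewrite !quadformE.
have -> : dotv (vh *m Uh) vh - dotv (v *m U) v =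
    dotv (vh *m (Uh - U)) vh + dotv ((vh - v) *m U) (vh + v).
  rewrite mulmxBr mulmxBl !(dotvBl, dotvDr).
  rewrite (dotvC (v *m U) vh) [dotv (vh *m U) v]dotv_mulmx Usym; ring.
apply: le_trans (ler_normD _ _) _; apply: lerD.
  apply: le_trans (normr_dotv_mulmx_le _ _ _) _.
  by rewrite -expr2 sqr_frobnorm_row hh mulr1.
apply: le_trans (normr_dotv_mulmx_le _ _ _) _.
rewrite [2 * _]mulrC -mulrA ler_wpM2l ?opnorm_ge0//.
(* With [c = dotv v vh], the two squared norms multiply to [(2 - 2 * c) * (2 + 2 * c) = 4 * (1 - c
   ^+ 2)]. *)
rewrite -ler_sqr ?nnegrE ?mulr_ge0 ?frobnorm_ge0//.
rewrite exprMn !sqr_frobnorm_row !(dotvBl, dotvBr, dotvDl, dotvDr).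
rewrite vv hh (dotvC vh v); nra.
Qed.

End Perturbation.

(** * Reducing subspaces and the envelope *)

Section Envelope.
Variables (R : realType) (p : nat).
Implicit Types (M U E S Q : 'M[R]_p).

(** Both vectors are collinear with [row j Q]. The coefficient is [dotv w v], written as a product
    of two coordinates. *)
Lemma simple_eigenline M Q (lam : seq R) (j : 'I_p) (v w : 'rV[R]_p) :
  M^T = M -> Q *m Q^T = 1%:M ->
  Q *m M = diag_mx (\row_(i < p) lam`_i) *m Q ->
  (forall k : 'I_p, k != j -> lam`_k != lam`_j) ->
  dotv v v = 1 -> v *m M = lam`_j *: v -> w *m M = lam`_j *: w ->
  exists c, w = c *: v.
Proof.
move=> Msym QQ QM simple vv vM wM.
have coord := simple_eigenvector Msym QQ QM simple.
pose c := dotv w (row j Q) * dotv v (row j Q); exists c.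
apply/eqP; rewrite -subr_eq0 -dotvv_eq0.
set y := w - _; rewrite {1}/y dotvBl dotvZl (coord _ wM y) (coord _ vM y) /c.
move: vv; rewrite (coord _ vM v) => vq1.
have -> : forall a b e : R, a * e - a * b * (b * e) = a * e * (1 - b * b).
  by move=> a b e; ring.
by rewrite vq1 subrr mulr0.
Qed.

(** The projection commutes with [M], hence preserves the line of [v], on which it acts as an
    idempotent scalar: 0 or 1. *)
Lemma reducing_eigenvector M S (v : 'rV[R]_p) a :
  reducing M S -> v != 0 -> v *m M = a *: v ->
  (forall w : 'rV[R]_p, w *m M = a *: w -> exists c, w = c *: v) ->
  (v <= S)%MS \/ v *m S^T = 0.
Proof.
rewrite /reducing /= => redM v0 vM simple.
have vPS := orthproj_sub v S; have vPC := orthproj_compl v S.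
move: redM (orthproj_idem S) vPS vPC; move: (orthproj S) => P redM PP vPS vPC.
have PQ : P *m (1%:M - P) = 0 by rewrite mulmxBr mulmx1 PP subrr.
have QP : (1%:M - P) *m P = 0 by rewrite mulmxBl mul1mx PP subrr.
(* Both products equal [P *m M *m P], since multiplying the reducing decomposition by [P] on either
   side kills its second term. *)
have PM : P *m M = M *m P.
  transitivity (P *m M *m P).
    by rewrite {1}redM mulmxDr !mulmxA PP PQ !mul0mx addr0.
  by rewrite [in RHS]redM mulmxDl -!mulmxA PP QP !mulmx0 addr0.
have [|c vP] := simple (v *m P).
  by rewrite -mulmxA PM mulmxA vM -scalemxAl.
have : (c * (c - 1)) *: v == 0.
  rewrite mulrBr mulr1 scalerBl subr_eq0 -scalerA -vP scalemxAl -vP.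
  by rewrite -mulmxA PP.
rewrite scaler_eq0 (negPf v0) orbF mulf_eq0 subr_eq0 => /orP[]/eqP c01.
  by right; rewrite -vPC vP c01 scale0r subr0.
by left; rewrite -[v]scale1r -c01 -vP.
Qed.

(** If [v] were orthogonal to a reducing [S] containing the column space of [U], then [v *m U] would
    vanish and the score with it. *)
Lemma eigenvector_sub_envelope M U E (v : 'rV[R]_p) a :
  is_envelope M U E -> v != 0 -> v *m M = a *: v ->
  (forall w : 'rV[R]_p, w *m M = a *: w -> exists c, w = c *: v) ->
  0 < quadform U v -> (v <= E)%MS.
Proof.
move=> envE v0 vM simple Uv; apply/envE => S redM /submxP[Y UE].
have [//|vS] := reducing_eigenvector redM v0 vM simple.
move: Uv; rewrite quadformE -[U]trmxK UE trmx_mul mulmxA vS.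
by rewrite mul0mx /dotv mul0mx mxE ltxx.
Qed.

End Envelope.

(** * Sorted scores, selected rows and the eigen-gap *)

Section Selection.
Variable R : realType.

(** The first [k.+1] sorted entries all qualify; ties may add more, hence an inequality. *)
Lemma count_ge_nth_sort (s : seq R) k :
  (k < size s)%N -> (k < count (fun x => ((sort >=%R s)`_k <= x)%R) s)%N.
Proof.
move=> ks; set t := sort _ s; have tk : (k < size t)%N by rewrite size_sort.
have /permP <- : perm_eq t s by rewrite perm_sort.
rewrite -(cat_take_drop k.+1 t) count_cat cat_take_drop.
apply: leq_trans (leq_addr _ _).
suff : all (fun x => t`_k <= x) (take k.+1 t).
  by rewrite all_count size_takel// => /eqP ->.
apply/(all_nthP 0) => i; rewrite size_takel// => ik; rewrite nth_take//.
by apply: sorted_ge_nth => //; apply: sort_sorted => x y; exact: le_total.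
Qed.

Lemma card_score_ge p d (U : 'M[R]_p) (V : 'M[R]_(d, p)) u :
  (0 < u)%N -> (u <= d)%N ->
  (u <= #|[set j | (score_gap U V u <= score U V j)%R]|)%N.
Proof.
case: u => // u _ ud; rewrite /score_gap /=.
set s := [seq _ | j : 'I_d].
apply: leq_trans (count_ge_nth_sort (_ : (u < size s)%N)) _.
  by rewrite size_map size_enum_ord.
rewrite count_map -sum1_count big_enum_cond -sum1_card /=.
by rewrite (eq_bigl (mem [set j | ((sort >=%R s)`_u <= score U V j)%R]))// => j;
   rewrite !inE.
Qed.

Lemma rowsub_orthonormal m n p (f : 'I_m -> 'I_n) (V : 'M[R]_(n, p)) :
  injective f -> V *m V^T = 1%:M -> rowsub f V *m (rowsub f V)^T = 1%:M.
Proof.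
move=> f_inj VV; apply/matrixP => i j.
by rewrite -dotv_row !row_rowsub dotv_row VV !mxE (inj_eq f_inj).
Qed.

Lemma orthonormal_rank n p (W : 'M[R]_(n, p)) :
  W *m W^T = 1%:M -> \rank W = n.
Proof. by move=> WW; apply/eqP/row_freeP; exists W^T. Qed.

Lemma sumsmx_row_rowsub n p (J : {set 'I_n}) (V : 'M[R]_(n, p)) :
  (\sum_(j in J) <<row j V>> :=: rowsub (fun k : 'I_#|J| => enum_val k) V)%MS.
Proof.
apply/eqmxP/andP; split.
  apply/sumsmx_subP => j jJ; rewrite genmxE.
  have -> : row j V = row (enum_rank_in jJ j) (rowsub (fun k : 'I_#|J| => enum_val k) V).
    by rewrite row_rowsub enum_rankK_in.
  exact: row_sub.
apply/row_subP => k; rewrite row_rowsub.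
by rewrite (sumsmx_sup (enum_val k)) ?enum_valP// genmxE.
Qed.

Lemma is_niece_rank p d u (M U E : 'M[R]_p) : is_niece d u M U E -> \rank E = u.
Proof.
case=> lam [V [J [_ [VV _] <- _ ->]]].
by rewrite sumsmx_row_rowsub orthonormal_rank// rowsub_orthonormal//; exact: enum_val_inj.
Qed.

(** Both indices are in range, so the default [-oo] is not reached and the term is a difference of
    reals. *)
Lemma eigengap_nth d (lam : seq R) j : (j < d)%N -> (j.+1 < size lam)%N ->
  (eigengap d lam <= (lam`_j - lam`_j.+1)%:E)%E.
Proof.
move=> jd jn; rewrite /eigengap.
apply: le_trans (bigmin_le_cond _ _ (_ : xpredT (Ordinal jd))) _ => //=.
by rewrite !(nth_map 0)// ltnW.
Qed.

End Selection.

(** * The subspace bound for a real eigen-gap [delta] *)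

Section RealBound.
Variables (R : realType) (p d u : nat) (M U E Mh Uh Eh : 'M[R]_p).
Variables (lam : seq R) (V : 'M[R]_(d, p)) (eps delta : R).
Hypotheses (u_gt0 : (0 < u)%N) (le_ud : (u <= d)%N) (le_dp : (d <= p)%N).
Hypotheses (Msym : M^T = M) (Usym : U^T = U).
Hypotheses (Mhsym : Mh^T = Mh).
Hypotheses (envE : is_envelope M U E) (rankE : \rank E = u).
Hypotheses (spM : is_spectrum M lam) (evM : leading_eigenvectors M lam V).
Hypothesis delta_gt0 : 0 < delta.
Hypothesis gap : forall j, (j < d)%N -> (j.+1 < size lam)%N ->
  delta <= lam`_j - lam`_j.+1.
Hypothesis gapU_gt0 : 0 < score_gap U V u.
Hypothesis eps_gt0 : 0 < eps.
Hypothesis eps_delta : eps <= delta / 4.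
Hypothesis eps_gapU :
  eps * (1 + 10 * opnorm U / delta) <= score_gap U V u / 2.
Hypotheses (opM : opnorm (Mh - M) <= eps) (opU : opnorm (Uh - U) <= eps).

Let VV : V *m V^T = 1%:M := evM.1.

Let size_lam : size lam = p.
Proof.
by have := size_char_poly M; rewrite spM.2 size_prod_XsubC => -[].
Qed.

(** By monotonicity one adjacent gap suffices: the one after [k] if [k < j], the one after [j] if
    [j < k]. *)
Lemma eigenvalue_separation (j : 'I_d) (k : 'I_p) :
  k != widen_ord le_dp j -> delta <= `|lam`_k - lam`_j|.
Proof.
rewrite -val_eqE /= neq_ltn => /orP[kj|jk].
  have kd : (k < d)%N by apply: ltn_trans kj _.
  have jp : (j < p)%N by apply: leq_trans le_dp.
  rewrite ger0_norm; last first.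
    by rewrite subr_ge0 sorted_ge_nth ?size_lam ?(ltnW kj) ?spM.1.
  apply: le_trans (gap kd _) _; first by rewrite size_lam (leq_ltn_trans kj).
  by rewrite lerD2l lerN2 sorted_ge_nth ?size_lam ?spM.1.
rewrite distrC ger0_norm; last first.
  by rewrite subr_ge0 sorted_ge_nth ?size_lam ?(ltnW jk) ?spM.1.
apply: le_trans (gap (ltn_ord j) _) _; first by rewrite size_lam (leq_ltn_trans jk).
by rewrite lerD2l lerN2 sorted_ge_nth ?size_lam ?spM.1.
Qed.

Section Sample.
Variables (lamh : seq R) (Vh : 'M[R]_(d, p)).
Hypotheses (spMh : is_spectrum Mh lamh).
Hypothesis evMh : leading_eigenvectors Mh lamh Vh.

Let row_unit (W : 'M[R]_(d, p)) j : W *m W^T = 1%:M -> dotv (row j W) (row j W) = 1.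
Proof. by move=> WW; rewrite dotv_row WW mxE eqxx. Qed.

(** The operator norm controls the difference of the quadratic forms in both directions, so
    [weyl_le] applies twice with the matrices exchanged. *)
Lemma weyl_dist (j : 'I_p) : `|lamh`_j - lam`_j| <= eps.
Proof.
have quad (x : 'rV[R]_p) : `|dotv (x *m Mh) x - dotv (x *m M) x| <= eps * dotv x x.
  rewrite -dotvBl -mulmxBr; apply: le_trans (normr_dotv_mulmx_le _ _ _) _.
  by rewrite -expr2 sqr_frobnorm_row ler_wpM2r ?dotvv_ge0.
have lo : lam`_j <= lamh`_j + eps.
  by apply: (weyl_le _ Msym Mhsym spM spMh) => x;
    have := quad x; rewrite ler_norml => /andP[+ _]; lra.
have hi : lamh`_j <= lam`_j + eps.
  by apply: (weyl_le _ Mhsym Msym spMh spM) => x;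
    have := quad x; rewrite ler_norml => /andP[_ +]; lra.
by rewrite ler_norml; lra.
Qed.

Lemma sin_theta_row j :
  1 - dotv (row j V) (row j Vh) ^+ 2 <= (4 * eps / (3 * delta)) ^+ 2.
Proof.
have [Q QQ QM] := symmetric_spectral Msym spM.2.
apply: (sin_theta_le (j := widen_ord le_dp j) (mu := lamh`_j) Msym QQ QM Mhsym) => //.
- exact: ltW.
- by move=> k /eigenvalue_separation.
- exact: row_unit.
- by rewrite evM.2.
- exact/row_unit/evMh.1.
- by rewrite evMh.2.
- exact: (weyl_dist (widen_ord le_dp j)).
Qed.

Lemma score_row j :
  `|score Uh Vh j - score U V j| <= eps + 2 * opnorm U * (4 * eps / (3 * delta)).
Proof.
apply: score_perturbation (sin_theta_row j) opU => //.
- exact: row_unit.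
- exact/row_unit/evMh.1.
- by rewrite divr_ge0// mulr_ge0// ltW.
Qed.

Lemma pos_score_sub j : 0 < score U V j -> (row j V <= E)%MS.
Proof.
have [Q QQ QM] := symmetric_spectral Msym spM.2.
have vv := row_unit j VV; have vM := evM.2 j.
apply: (eigenvector_sub_envelope envE _ vM); first by rewrite -dotvv_eq0 vv oner_eq0.
move=> w wM; apply: (simple_eigenline (j := widen_ord le_dp j) Msym QQ QM) => //.
move=> k /eigenvalue_separation; apply: contraTneq => -> /=.
by rewrite subrr normr0 -ltNge.
Qed.

(** A threshold rather than a choice of [u] indices; that it selects exactly [u] of them is part of
    [envelope_selection]. *)
Let J := [set j | score_gap U V u <= score U V j].

(** At least [u] scores reach the threshold. Rows with positive score are orthonormal and lie in
    [E], of rank [u], so there are at most [u]; equal ranks turn the inclusion into an equality. *)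
Lemma envelope_selection :
  [/\ #|J| = u, (E :=: rowsub (fun k : 'I_#|J| => enum_val k) V)%MS
    & forall j, j \notin J -> score U V j <= 0].
Proof.
have sub_card (K : {set 'I_d}) : (forall j, j \in K -> 0 < score U V j) ->
    (#|K| <= u)%N * (rowsub (fun k : 'I_#|K| => enum_val k) V <= E)%MS.
  move=> Kpos.
  have sub : (rowsub (fun k : 'I_#|K| => enum_val k) V <= E)%MS.
    by apply/row_subP => k; rewrite row_rowsub pos_score_sub ?Kpos ?enum_valP.
  split=> //; have := mxrankS sub.
  by rewrite rankE orthonormal_rank// rowsub_orthonormal//; exact: enum_val_inj.
have Jpos j : j \in J -> 0 < score U V j.
  by rewrite inE; exact: lt_le_trans.
have [Ju JE] := sub_card _ Jpos.
have cardJ : #|J| = u by apply/eqP; rewrite eqn_leq Ju card_score_ge.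
split=> // [|j jJ].
  apply/eqmx_sym/eqmxP; rewrite -(geq_leqif (mxrank_leqif_eq JE)) rankE.
  by rewrite orthonormal_rank ?cardJ// rowsub_orthonormal//; exact: enum_val_inj.
rewrite leNgt; apply/negP => jpos.
(* Adding [j] to [J] would put [u.+1] orthonormal rows inside [E]. *)
have [|+ _] := sub_card (j |: J).
  by move=> k; rewrite !inE => /orP[/eqP->//|kJ]; apply: Jpos; rewrite inE.
by rewrite cardsU1 jJ cardJ ltnn.
Qed.

(** With [t = opnorm U * eps / delta], each score moves by at most [eps + 8 / 3 * t], while
    [eps + 10 * t] is at most half the score gap. *)
Lemma score_separation i j : i \in J -> j \notin J ->
  score Uh Vh j < score Uh Vh i.
Proof.
have [_ _ neg] := envelope_selection => iJ /neg j0.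
have i0 : score_gap U V u <= score U V i by move: iJ; rewrite inE.
(* A positive score forces [U] to be nonzero; then [t] is positive and the separation strict. *)
have nu0 : 0 < opnorm U.
  apply: lt_le_trans gapU_gt0 (le_trans i0 _); apply: le_trans (ler_norm _) _.
  apply: le_trans (normr_dotv_mulmx_le _ _ _) _.
  by rewrite -expr2 sqr_frobnorm_row row_unit// mulr1.
have := score_row i; have := score_row j; rewrite !ler_norml => /andP[_ hj] /andP[hi _].
have t0 : 0 < opnorm U * eps / delta by rewrite divr_gt0// mulr_gt0.
have e1 : 2 * opnorm U * (4 * eps / (3 * delta)) = 8 / 3 * (opnorm U * eps / delta).
  by field; rewrite gt_eqF.
have e2 : eps * (1 + 10 * opnorm U / delta) = eps + 10 * (opnorm U * eps / delta).
  by field; rewrite gt_eqF.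
move: eps_gapU hi hj; rewrite e1 e2; lra.
Qed.

(** An index of [J] missing from [Jh] would, by equal cardinality, come with an index of [Jh]
    outside [J], and their sample scores would be in the wrong order. *)
Lemma sample_selection (Jh : {set 'I_d}) : #|Jh| = u ->
  (forall i j : 'I_d, i \in Jh -> j \notin Jh -> score Uh Vh j <= score Uh Vh i) ->
  Jh = J.
Proof.
move=> cardJh top; have [cardJ _ _] := envelope_selection.
apply/esym/eqP; rewrite eqEcard cardJ cardJh leqnn andbT.
apply/subsetPn => -[i iJ iJh].
have [JhJ|/subsetPn[j jJh jJ]] := boolP (Jh \subset J).
  have /eqP JhE : Jh == J by rewrite eqEcard JhJ cardJ cardJh /=.
  by rewrite JhE iJ in iJh.
by have := score_separation iJ jJ; rewrite ltNge top.
Qed.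

End Sample.

Lemma niece_real_bound : is_niece d u Mh Uh Eh ->
  frobnorm (orthproj Eh - orthproj E) <= 2 * Num.sqrt (2 * u%:R) / delta * eps.
Proof.
case=> lamh [Vh [Jh [spMh evMh cardJh top EhE]]].
have JhJ := sample_selection spMh evMh cardJh top.
have [cardJ EE _] := envelope_selection.
rewrite -JhJ in EE.
pose W (X : 'M[R]_(d, p)) := rowsub (fun k : 'I_#|Jh| => enum_val k) X.
have WW X : X *m X^T = 1%:M -> W X *m (W X)^T = 1%:M.
  by move=> XX; rewrite rowsub_orthonormal//; exact: enum_val_inj.
have EhW : (Eh :=: W Vh)%MS := eqmx_trans EhE (sumsmx_row_rowsub Jh Vh).
rewrite (orthproj_orthonormal (WW _ VV) EE) (orthproj_orthonormal (WW _ evMh.1) EhW).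
rewrite -ler_sqr ?nnegrE ?frobnorm_ge0//; last first.
  by rewrite mulr_ge0 ?(ltW eps_gt0)// divr_ge0 ?(ltW delta_gt0)// mulr_ge0 ?sqrtr_ge0.
apply: le_trans (sqr_frobnorm_proj_sub (WW _ evMh.1) (WW _ VV)) _.
(* The squared bound is spread over the [u] selected indices, to be compared term by term. *)
have -> : (2 * Num.sqrt (2 * u%:R) / delta * eps) ^+ 2 =
    2 * (\sum_(k < #|Jh|) (2 * eps / delta) ^+ 2).
  rewrite sumr_const card_ord cardJh -[in RHS]mulr_natr !exprMn sqr_sqrtr ?mulr_ge0//.
  by ring.
rewrite ler_pM2l//; apply: ler_sum => k _; rewrite !row_rowsub dotvC.
apply: le_trans (sin_theta_row spMh evMh _) _.
rewrite ler_sqr ?nnegrE ?divr_ge0 ?mulr_ge0 ?(ltW eps_gt0) ?(ltW delta_gt0)//.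
(* The constant [4 / 3] of the residual argument is below the required 2. *)
have -> : 4 * eps / (3 * delta) = 4 / 3 * (eps / delta) by field; rewrite gt_eqF.
have := divr_gt0 eps_gt0 delta_gt0; lra.
Qed.

End RealBound.

(** * From the extended-real gap to the real bound *)

Theorem theorem1 (R : realType) (p d u : nat) (M U E : 'M[R]_p)
    (lam : seq R) (V : 'M[R]_(d, p)) (Mh Uh Eh : 'M[R]_p) (eps : R)
    (Delta := eigengap d lam) (DeltaU := score_gap U V u) (nu := opnorm U) :
  (1 <= u)%N -> (u <= d)%N -> (d <= p)%N ->
  M^T = M -> posdef M ->
  U^T = U -> possemidef U ->
  is_envelope M U E -> \rank E = u ->
  is_spectrum M lam -> leading_eigenvectors M lam V ->
  uniq (take d lam) -> (0 < Delta)%E ->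
  (E <= V)%MS ->
  0 < DeltaU ->
  Mh^T = Mh -> possemidef Mh ->
  Uh^T = Uh -> possemidef Uh ->
  is_niece d u Mh Uh Eh ->
  0 < eps ->
  (eps%:E <= mine (Delta / 4%:E)
                  ((DeltaU / 2)%:E * (1 + (10 * nu)%:E / Delta)^-1))%E ->
  opnorm (Mh - M) <= eps ->
  opnorm (Uh - U) <= eps ->
  ((frobnorm (orthproj Eh - orthproj E))%:E
     <= (2 * Num.sqrt (2 * u%:R))%:E / Delta * eps%:E)%E.
Proof.
move=> u0 ud dp Msym _ Usym _ envE rankE spM evM _ Delta_gt0 _ DeltaU_gt0.
move=> Mhsym _ _ _ niece eps_gt0 eps_le opM opU.
(* If [p = 1], the only case of an infinite gap, both projections are the identity and the left side
   is 0. *)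
have [p1|p1] := leqP p 1.
  have up : u = p.
    by apply/eqP; rewrite eqn_leq (leq_trans ud dp) (leq_trans p1 u0).
  rewrite !orthproj_full ?(is_niece_rank niece) ?rankE// subrr frobnorm0.
  rewrite mule_ge0 ?lee_fin ?(ltW eps_gt0)// mule_ge0//.
    by rewrite lee_fin mulr_ge0 ?sqrtr_ge0.
  by rewrite inve_ge0 ltW.
have size_lam : size lam = p.
  by have := size_char_poly M; rewrite spM.2 size_prod_XsubC => -[].
have gap j : (j < d)%N -> (j.+1 < size lam)%N ->
    (Delta <= (lam`_j - lam`_j.+1)%:E)%E by exact: eigengap_nth.
(* For [p > 1] the first eigenvalue difference is finite, which rules out [Delta = +oo]; positivity
   rules out [-oo]. *)
have := gap 0 (leq_trans u0 ud); rewrite size_lam => /(_ p1).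
move: gap Delta_gt0 eps_le; case: (Delta) => [delta| |] //.
move=> gap; rewrite lte_fin => delta_gt0 eps_le _.
have delta_neq0 : delta != 0 by rewrite gt_eqF.
have nu_ge0 : 0 <= nu by exact: opnorm_ge0.
have nud_ge0 : 0 <= 10 * nu / delta by rewrite divr_ge0 ?(ltW delta_gt0)// mulr_ge0.
have c_gt0 : 0 < 1 + 10 * nu / delta by rewrite ltr_pwDl.
(* The inverted quantities are nonzero reals, so the extended inverses become real ones. *)
move: eps_le; rewrite !inver (negPf delta_neq0) pnatr_eq0 /=.
rewrite -!EFinM -EFinD inver (gt_eqF c_gt0) -EFinM le_min !lee_fin.
move=> /andP[eps_delta]; rewrite ler_pdivlMr// => eps_gapU.
apply: (@niece_real_bound _ _ d u M U E Mh Uh Eh lam V eps delta u0 ud dp Msym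
  Usym Mhsym envE rankE spM evM) => //.
Qed.
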